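(* For every support-preserving multiplicative map $\Phi\colon\mathcal{P}\to\mathcal{P}$ there exists a constant $\gamma>0$ such that $\Phi[p](x)=p(\gamma x)/p(\gamma)$ for all $p\in\mathcal{P}$.
   Context: $\mathcal{P}$ is the set of real polynomials $p(x)=\sum_{k=0}^n p_kx^k$ in one variable (of arbitrary degree) with $p_k\geq 0$ for all $k$ and $p(1)=1$. A map $\Phi\colon\mathcal{P}\to\mathcal{P}$ is support-preserving if for every $p\in\mathcal{P}$ and every $k$, writing $p'=\Phi[p]$, one has $p'_k>0$ if and only if $p_k>0$. It is multiplicative if $\Phi[p\cdot q]=\Phi[p]\cdot\Phi[q]$ for all $p,q\in\mathcal{P}$. *)

(* Defs.v *)
From HB Require Import structures.
From mathcomp Require Import all_boot all_order all_algebra.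
From mathcomp Require Import reals.

Set Implicit Arguments.
Unset Strict Implicit.
Unset Printing Implicit Defensive.

Import Order.TTheory GRing.Theory Num.Theory.
Local Open Scope ring_scope.

Section NormalizedPolynomials.
Variable R : realType.

Definition normalized_nneg (p : {poly R}) : bool :=
  (p \is a polyOver Num.nneg) && (p.[1] == 1).

Record normPoly := NormPoly {
  normPoly_val :> {poly R};
  _ : normalized_nneg normPoly_val }.

HB.instance Definition _ := [isSub for normPoly_val].
HB.instance Definition _ := [Choice of normPoly by <:].

Lemma normalized_nnegM (p q : normPoly) :
  normalized_nneg ((p : {poly R}) * (q : {poly R})).
Proof.
case: p q => [p /andP[p0 /eqP p1]] [q /andP[q0 /eqP q1]] /=.
by apply/andP; split; [exact: polyOver_mulr_2closed | rewrite hornerM p1 q1 mulr1].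
Qed.

Definition normPoly_mul (p q : normPoly) : normPoly :=
  NormPoly (normalized_nnegM p q).

Definition support_preserving (Phi : normPoly -> normPoly) : Prop :=
  forall (p : normPoly) (k : nat), 0 < (Phi p)`_k <-> 0 < p`_k.

Definition multiplicative_map (Phi : normPoly -> normPoly) : Prop :=
  forall p q : normPoly,
    Phi (normPoly_mul p q) = normPoly_mul (Phi p) (Phi q).

End NormalizedPolynomials.

(* Main.v *)
(* Each linear factor ['X + a] is mapped to a multiple of ['X + f a].  The idea is
   to exploit vanishing coefficients of products with polynomials of the form
   ['X^2 - c *: 'X + c * e] with [0 < c < e], which are not in the domain of [Phi]
   but become so after multiplication by ['X + c], in such a way that their image
   is a multiple of ['X^2 - f c *: 'X + d] for some [d]; the same holds with ['X^j]
   in place of ['X], with a function [f_j] in place of [f].  If [p] has degree [n]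
   and no gaps in its support, then, for [c = p_(n - j) / p_n], [e] large and a
   suitable [b], the product of [p], ['X^(2j) - c *: 'X^j + c * e] and
   ['X^(j+1) + b] has nonnegative coefficients, and the one of index [n + 2j + 1]
   is [p_(n - j) - c * p_n = 0].  As [Phi] preserves this zero, the ratio
   [p_(n - j) / p_n] is mapped by [f_j].  Taking [p = ('X + a) * ('X + b)] shows
   that [f] is additive, hence linear, and [p = ('X + a) * ('X + 1) ^+ (j - 1)]
   determines [f_j]; a general [p] is reached by multiplying it by a power of
   ['X + 1], which fills the gaps. *)

Require Import Defs.
From HB Require Import structures.
From mathcomp Require Import all_boot all_order all_algebra.
From mathcomp Require Import reals.
From mathcomp Require Import ring lra zify.

Set Implicit Arguments.
Unset Strict Implicit.
Unset Printing Implicit Defensive.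

Import Order.TTheory GRing.Theory Num.Theory.
Local Open Scope ring_scope.

Ltac nlia :=
  repeat match goal with
  | H : is_true (leq _ _) |- _ => revert H
  | H : is_true (andb _ _) |- _ => revert H
  end; clear; lia.

(** * Additive functions on the positive reals *)

Lemma additive_pos_linear (R : archiRealFieldType) (f : R -> R) :
  (forall a, 0 < a -> 0 < f a) ->
  (forall a b, 0 < a -> 0 < b -> f (a + b) = f a + f b) ->
  forall a, 0 < a -> f a = a * f 1.
Proof.
move=> f_gt0 fD a a_gt0.
have fMn n b : 0 < b -> f (b *+ n.+1) = f b *+ n.+1.
  move=> b_gt0; elim: n => [//|n IHn].
  by rewrite mulrS fD ?pmulrn_lgt0 // IHn -mulrS.
have f_incr b c : 0 < b -> b < c -> f b < f c.
  move=> b_gt0 bc; rewrite -(subrK b c) addrC fD ?subr_gt0 //.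
  by rewrite ltrDl f_gt0 ?subr_gt0.
have f1 := f_gt0 1 ltr01.
(* With [N = n.+1] and [m] the integer part of [N a], monotonicity puts both [N f(a)] and [N a f(1)]
   between [m f(1)] and [(m + 1) f(1)]. As [N] is arbitrary, [f a] and [a * f 1] must agree. *)
have bound n : `|f a *+ n.+1 - a * f 1 *+ n.+1| <= f 1.
  have na : 0 < a *+ n.+1 by rewrite pmulrn_lgt0.
  have := truncn_itv (ltW na); set m := Num.truncn _ => /andP[ma am].
  have up : f a *+ n.+1 < f 1 *+ m.+1 by rewrite -!fMn ?f_incr.
  have lo : f 1 *+ m <= f a *+ n.+1.
    (* The case [m = 0] is apart, since [f] is only controlled at positive arguments. *)
    case: m ma {am up} => [_|m ma]; first by rewrite mulr0n mulrn_wge0 ?ltW ?f_gt0.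
    rewrite -!fMn //; move: ma; rewrite le_eqVlt => /predU1P[->//|ma].
    by rewrite ltW ?f_incr ?ltr0n.
  have : a *+ n.+1 * f 1 <= f 1 *+ m.+1.
    by rewrite -[f 1 *+ _]mulr_natl ler_pM2r // ltW.
  have : f 1 *+ m <= a *+ n.+1 * f 1 by rewrite -[f 1 *+ _]mulr_natl ler_pM2r.
  rewrite mulrnAl ler_norml; move: up lo; rewrite [f 1 *+ m.+1]mulrS.
  by move=> up lo le1 le2; apply/andP; split; lra.
apply/eqP; rewrite -subr_eq0; apply/negPn/negP => neq0.
have d_gt0 : 0 < `|f a - a * f 1| by rewrite normr_gt0.
pose n := Num.truncn (f 1 / `|f a - a * f 1|).
have := bound n; rewrite -mulrnBl normrMn leNgt -mulr_natl -ltr_pdivrMr //.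
by rewrite truncnS_gt.
Qed.

(** * Nonzero polynomials with nonnegative coefficients *)

Section NonnegPoly.
Variable R : realType.
Implicit Types p q : {poly R}.

(** The value at 1 is left free; it is automatically positive, so that such a polynomial can be
    normalized. *)
Definition nneg_poly p := (p \is a polyOver Num.nneg) && (p != 0).

Lemma nneg_polyP p :
  reflect ((forall i, 0 <= p`_i) /\ exists i, p`_i != 0) (nneg_poly p).
Proof.
apply: (iffP andP) => [[/polyOverP p0 pn0]|[p0 [i pi]]]; split.
- by move=> i; have := p0 i; rewrite nnegrE.
- by exists (size p).-1; rewrite -lead_coefE lead_coef_eq0.
- by apply/polyOverP => k; rewrite nnegrE.
- by apply: contraNneq pi => ->; rewrite coef0.
Qed.

Lemma nneg_polyM p q : nneg_poly p -> nneg_poly q -> nneg_poly (p * q).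
Proof.
move=> /andP[p0 pn0] /andP[q0 qn0].
by rewrite /nneg_poly mulf_neq0 // andbT; exact: polyOver_mulr_2closed.
Qed.

Lemma nneg_polyXn p n : nneg_poly p -> nneg_poly (p ^+ n).
Proof.
move=> p0; elim: n => [|n IHn]; last by rewrite exprS nneg_polyM.
by apply/nneg_polyP; split=> [i|]; [rewrite coef1 | exists 0%N; rewrite coef1 oner_eq0].
Qed.

Lemma nneg_poly_horner_gt0 p x : nneg_poly p -> 0 < x -> 0 < p.[x].
Proof.
move=> /nneg_polyP[p0 [i pi]] x_gt0.
have ltip : (i < size p)%N by rewrite ltnNge; apply: contraNN pi => /(nth_default 0) ->.
rewrite horner_coef (bigD1 (Ordinal ltip)) //= ltr_wpDr //.
  by apply: sumr_ge0 => k _; rewrite mulr_ge0 ?exprn_ge0 // ltW.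
by rewrite mulr_gt0 ?exprn_gt0 // lt_neqAle eq_sym pi p0.
Qed.

Lemma nneg_poly_coef_le p i : nneg_poly p -> p`_i <= p.[1].
Proof.
move=> /nneg_polyP[p0 _]; rewrite horner_coef.
under eq_bigr do rewrite expr1n mulr1.
have [lti|?] := ltnP i (size p); last by rewrite nth_default // sumr_ge0.
by rewrite (bigD1 (Ordinal lti)) //= lerDl sumr_ge0.
Qed.

Lemma nneg_polyXnD j a : 0 < a -> nneg_poly ('X^j + a%:P).
Proof.
move=> a0; apply/nneg_polyP; split=> [i|].
  by rewrite coefD coefXn coefC addr_ge0 //; case: ifP => // _; apply: ltW.
by exists 0%N; rewrite coefD coefXn coefC /= gt_eqF // ltr_wpDl.
Qed.

Lemma coef_comp_polyXnM p i j : (0 < j)%N -> (p \Po 'X^j)`_(i * j) = p`_i.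
Proof. by move=> j0; rewrite coef_comp_poly_Xn // dvdn_mull // mulnK. Qed.

Lemma comp_polyXn_inj j p q : (0 < j)%N -> p \Po 'X^j = q \Po 'X^j -> p = q.
Proof.
move=> j0 e; apply/polyP => i.
by rewrite -(coef_comp_polyXnM p i j0) e coef_comp_polyXnM.
Qed.

Lemma nneg_poly_compXn j p : (0 < j)%N -> nneg_poly p -> nneg_poly (p \Po 'X^j).
Proof.
move=> j0 /nneg_polyP[p0 [i pi]]; apply/nneg_polyP; split=> [k|].
  by rewrite coef_comp_poly_Xn //; case: ifP.
by exists (i * j)%N; rewrite coef_comp_polyXnM.
Qed.

Lemma coef_comp_scaleX p (g : R) i : (p \Po (g *: 'X))`_i = p`_i * g ^+ i.
Proof.
have -> : p \Po (g *: 'X) = \poly_(k < size p) (p`_k * g ^+ k).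
  by rewrite comp_polyE poly_def; apply: eq_bigr => k _; rewrite exprZn scalerA.
by rewrite coef_poly; case: ltnP => // le_i; rewrite nth_default // mul0r.
Qed.

Lemma seq_pos_lower_bound (s : seq R) :
  exists2 d, 0 < d & {in s, forall x, 0 < x -> d <= x}.
Proof.
elim: s => [|y s [d d0 ds]]; first by exists 1.
have [y0|y0] := ltP 0 y; last first.
  exists d => // x; rewrite inE => /predU1P[->|/ds//].
  by rewrite ltNge y0.
exists (Num.min y d) => [|x]; first by rewrite lt_min y0.
by rewrite inE ge_min => /predU1P[->|xs x0]; rewrite ?lexx ?(ds _ xs x0) ?orbT.
Qed.

Lemma coef_pos_lower_bound p : exists2 d, 0 < d & forall i, 0 < p`_i -> d <= p`_i.
Proof.
have [d d0 dp] := seq_pos_lower_bound p; exists d => // i pi.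
apply: dp => //; apply: mem_nth; rewrite ltnNge.
by apply: contraTN pi => /(nth_default 0) ->; rewrite ltxx.
Qed.

(** * Multiplication by binomials and by quadratics in ['X^j] *)

Lemma coef_XnDM j a p i :
  (('X^j + a%:P) * p)`_i = (if (i < j)%N then 0 else p`_(i - j)) + a * p`_i.
Proof. by rewrite mulrDl coefD coefXnM coefCM. Qed.

Lemma XnDE j (a : R) : 'X^j + a%:P = ('X + a%:P) \Po 'X^j.
Proof. by rewrite comp_polyD comp_polyX comp_polyC. Qed.

(** The constant [d] is [c * e] before [Psi] is applied, and an unknown real in the image. *)
Definition quad (c d : R) j : {poly R} := 'X^(j * 2) - c *: 'X^j + d%:P.

Lemma quadE c d j : quad c d j = ('X^2 - c *: 'X + d%:P) \Po 'X^j.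
Proof.
by rewrite comp_polyD comp_polyB comp_polyZ comp_polyC comp_polyX rmorphXn /= comp_polyX -exprM.
Qed.

Lemma coef_quadM c d j p i : (quad c d j * p)`_i =
  (if (i < j * 2)%N then 0 else p`_(i - j * 2))
  - c * (if (i < j)%N then 0 else p`_(i - j)) + d * p`_i.
Proof. by rewrite 2!mulrDl mulNr -scalerAl !(coefD, coefN, coefZ, coefXnM, coefCM). Qed.

(** The factor ['X^(j.+1)] reads index [n + j] of [quad c d j * p], where [d] would multiply a
    coefficient of [p] beyond [n]; [b] would multiply a coefficient beyond [n + j * 2]. Hence
    neither [b] nor [d] enters. *)
Lemma coef_quadM_top (b c d : R) n j p : (0 < j)%N -> (j <= n)%N ->
  (forall i, (n < i)%N -> p`_i = 0) ->
  (('X^(j.+1) + b%:P) * (quad c d j * p))`_(n + j * 2).+1 = p`_(n - j) - c * p`_n.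
Proof.
move=> j0 le_jn p_gt; rewrite coef_XnDM !coef_quadM subSS ltnS.
rewrite ![(_ < _)%N]ltnNge (_ : j <= _)%N /=; last by nlia.
rewrite (_ : j * 2 <= _)%N /=; last by nlia.
rewrite (_ : j * 2 <= _)%N /=; last by nlia.
rewrite (_ : j <= _)%N /=; last by nlia.
rewrite (_ : j <= _)%N /=; last by nlia.
rewrite (_ : n + j * 2 - j - j * 2 = n - j)%N; last by nlia.
rewrite (_ : n + j * 2 - j - j = n)%N; last by nlia.
rewrite (p_gt (n + j * 2 - j)%N); last by nlia.
rewrite (p_gt ((n + j * 2).+1 - j * 2)%N); last by nlia.
rewrite (p_gt ((n + j * 2).+1 - j)%N); last by nlia.
rewrite (p_gt (n + j * 2).+1); last by nlia.
by rewrite !mulr0 subr0 !addr0 mulr0 addr0.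
Qed.

(** Only the endpoints matter later: [a = c] kills the term in ['X^2], and [a = e] the term in
    ['X]. *)
Lemma nneg_XD_quad (c e a : R) : 0 < c -> c <= a <= e ->
  nneg_poly (('X + a%:P) * ('X^2 - c *: 'X + (c * e)%:P)).
Proof.
move=> c0 /andP[ca ae]; have a0 := lt_le_trans c0 ca.
have -> : ('X + a%:P) * ('X^2 - c *: 'X + (c * e)%:P) =
    'X^3 + (a - c) *: 'X^2 + (c * (e - a)) *: 'X + (c * e * a)%:P.
  by rewrite -!mul_polyC !(polyCM, polyCB); ring.
apply/nneg_polyP; split=> [i|]; last first.
  by exists 3; rewrite !coefD !coefZ !coefXn coefX coefC /= !mulr0 !addr0 oner_eq0.
rewrite !coefD !coefZ !coefXn coefX coefC.
rewrite !addr_ge0 ?mulr_ge0 ?subr_ge0 ?ler0n //; first exact: ltW.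
by case: ifP => // _; rewrite !mulr_ge0 // ltW // (lt_le_trans a0).
Qed.

Lemma nneg_XnD_quad j (c e : R) : (0 < j)%N -> 0 < c -> c < e ->
  nneg_poly (('X^j + c%:P) * quad c (c * e) j).
Proof.
move=> j0 c0 ce; rewrite XnDE quadE -comp_polyM nneg_poly_compXn //.
by rewrite nneg_XD_quad // lexx ltW.
Qed.

(* [b] compensates the negative coefficients of the product with [quad] that
   come from its term [- c *: 'X^j], and [e] those that [b] creates. *)
Lemma exists_nneg_quadM p n j : nneg_poly p -> size p = n.+1 ->
  (forall i, (i < n)%N -> 0 < p`_i -> 0 < p`_i.+1) ->
  (0 < j <= n)%N -> 0 < p`_(n - j) ->
  let c := p`_(n - j) / p`_n in
  exists b e : R, [/\ 0 < b, c < e &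
    nneg_poly (('X^(j.+1) + b%:P) * (quad c (c * e) j * p))].
Proof.
move=> pK sz up /andP[j0 jn] pnj c; have /nneg_polyP[p0 _] := pK.
have upW i k : (i <= k <= n)%N -> 0 < p`_i -> 0 < p`_k.
  case/andP => ik kn pi; elim: k ik kn => [|k IHk].
    by rewrite leqn0 => /eqP <-.
  by rewrite leq_eqVlt => /predU1P[<-//|ik] kn; apply: up => //;
    apply: IHk => //; exact: ltnW.
have pn : 0 < p`_n by apply: upW pnj; rewrite leq_subr leqnn.
have p_gt i : (n < i)%N -> p`_i = 0 by move=> ni; rewrite nth_default // sz.
have c0 : 0 < c by rewrite divr_gt0.
have [d d0 pd] := coef_pos_lower_bound p.
set A := p.[1]; have pA i : p`_i <= A by exact: nneg_poly_coef_le.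
have A0 : 0 < A := lt_le_trans pn (pA n).
pose b := c * A / d; pose e := (A + b * A) / d + c.
have b0 : 0 < b by rewrite divr_gt0 // mulr_gt0.
have e0 : 0 < (A + b * A) / d by rewrite divr_gt0 // addr_gt0 // mulr_gt0.
have bd : b * d = c * A by rewrite divfK ?gt_eqF.
have ed : A + b * A <= e * d by rewrite mulrDl divfK ?gt_eqF // lerDl mulr_ge0 // ltW.
have ced : c * A + b * (c * A) <= c * e * d.
  by rewrite -[c * e * d]mulrA mulrCA -mulrDr ler_pM2l.
exists b, e; split; rewrite ?ltrDr //.
(* [w] can be negative only strictly between [n] and [n + j], and is at least [- (c * A)] there. Up
   to [n], a positive [p]_(i - j)[forces a positive]p[_i], whose multiple by [c * e] dominates; at
   [n + j], [w] vanishes by the choice of [c]. *)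
pose w i := (quad c (c * e) j * p)`_i.
have ps0 i k : 0 <= (if (i < k)%N then 0 else p`_(i - k)) by case: ifP.
have psA i k : (if (i < k)%N then 0 else p`_(i - k)) <= A by case: ifP => // _; exact: ltW.
have wE i := coef_quadM c (c * e) j p i.
have cA0 : 0 < c * A by rewrite mulr_gt0.
have bcA0 : 0 < b * (c * A) by rewrite mulr_gt0.
have ce0 : 0 < c * e by rewrite mulr_gt0 // addr_gt0.
have w_lo i : - (c * A) + c * e * p`_i <= w i.
  rewrite /w wE lerD2r; have := ps0 i (j * 2)%N; have := psA i j.
  by rewrite -(ler_pM2l c0); lra.
have w_pos i : 0 < p`_i -> b * (c * A) <= w i.
  move=> /pd; rewrite -(ler_pM2l ce0); have := w_lo i; lra.
have w_le i : (i <= n)%N -> 0 <= w i.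
  move=> le_in; have [/w_pos|] := ltP 0 p`_i; first by apply: le_trans; rewrite ltW.
  move=> pi0; have pi : p`_i = 0 by apply/eqP; rewrite eq_le pi0 p0.
  rewrite /w wE pi; case: (ltnP i j) => [_|ji]; first by rewrite !mulr0 subr0 addr0.
  have -> : p`_(i - j) = 0.
    apply/eqP; rewrite eq_le p0 andbT leNgt; apply/negP => /(upW _ i).
    by rewrite pi ltxx leq_subr le_in => /(_ isT).
  by rewrite !mulr0 subr0 addr0.
have w_ge i : (n + j <= i)%N -> 0 <= w i.
  move=> le_i; rewrite /w wE [p`_i]p_gt ?mulr0 ?addr0; last by nlia.
  rewrite [(i < j)%N]ltnNge (leq_trans (leq_addl n j) le_i) /=.
  move: le_i; rewrite leq_eqVlt => /predU1P[<-|lt_i].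
    rewrite addnK divfK ?gt_eqF //; case: ltnP => ?; first by nlia.
    by rewrite (_ : (n + j - j * 2 = n - j)%N) ?subrr //; nlia.
  by rewrite [p`_(i - j)]p_gt ?mulr0 ?subr0 //; nlia.
have w_top i : (n + j < i <= n + j * 2)%N -> d <= w i.
  move=> /andP[lt_i le_i]; rewrite /w wE [p`_i]p_gt ?mulr0 ?addr0; last by nlia.
  rewrite ltnNge (_ : j * 2 <= i)%N /=; last by nlia.
  rewrite ltnNge (_ : j <= i)%N /=; last by nlia.
  rewrite [p`_(i - j)]p_gt ?mulr0 ?subr0; last by nlia.
  by apply: pd; apply: upW pnj; nlia.
apply/nneg_polyP; split=> [i|]; last first.
  exists (n + j * 2 + j.+1)%N; rewrite coef_XnDM ltnNge leq_addl /= addnK.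
  rewrite -/(w _) -/(w _) gt_eqF // ltr_wpDr //.
    by rewrite mulr_ge0 ?(ltW b0) // w_ge //; nlia.
  by rewrite (lt_le_trans d0) // w_top //; nlia.
rewrite coef_XnDM -/(w i) -/(w _).
have [lt_ij|le_ji] := ltnP i j.+1.
  by rewrite add0r mulr_ge0 ?(ltW b0) // w_le //; nlia.
have [in_|ni] := leqP i n.
  by apply: addr_ge0; [|apply: (mulr_ge0 (ltW b0))]; apply: w_le; nlia.
have [lt_i|le_i] := ltnP i (n + j).
  (* The index [i - j.+1] lies between [n - j] and [n], where [p] is positive, so [w_pos] makes up
     for [b * w i]. *)
  have := w_pos (i - j.+1)%N; rewrite (upW _ _ _ pnj); last by nlia.
  have := w_lo i; rewrite [p`_i]p_gt // mulr0 addr0 -(ler_pM2l b0).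
  by move=> ? /(_ isT); lra.
have wi := w_ge i le_i.
have [le_i1|lt_i1] := leqP i (n + j).+1.
  by apply: addr_ge0; [apply: w_le; nlia | exact: mulr_ge0 (ltW b0) wi].
have [le_i2|lt_i2] := leqP i (n + j * 2).
  (* Now [w (i - j.+1)] may be the negative term, and [b * d = c * A] covers it. *)
  have := w_top i; rewrite le_i2 (ltnW lt_i1) -(ler_pM2l b0) bd.
  have := w_lo (i - j.+1)%N; have := mulr_ge0 (ltW ce0) (p0 (i - j.+1)%N).
  by move=> ? ? /(_ isT); lra.
by apply: addr_ge0; [|apply: (mulr_ge0 (ltW b0))]; apply: w_ge; nlia.
Qed.

(** * Full supports and the filling of gaps *)

Definition pos_coefs n p := forall i, if (i <= n)%N then is_true (0 < p`_i) else p`_i = 0.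

Lemma size_pos_coefs n p : pos_coefs n p -> size p = n.+1.
Proof.
move=> pn; apply/eqP; rewrite eqn_leq; apply/andP; split.
  by apply/leq_sizeP => i ni; have := pn i; rewrite leqNgt ni.
rewrite ltnNge; apply/negP => /leq_sizeP/(_ n (leqnn _)) p0.
by have := pn n; rewrite leqnn p0 ltxx.
Qed.

Lemma pos_coefs_nneg n p : pos_coefs n p -> nneg_poly p.
Proof.
move=> pn; apply/nneg_polyP; split=> [i|].
  by have := pn i; case: ifP => _ => [/ltW|->].
by exists n; have := pn n; rewrite leqnn => /lt0r_neq0.
Qed.

Lemma pos_coefs_monic n p : pos_coefs n p -> p \is monic -> p`_n = 1.
Proof. by move=> /size_pos_coefs sz /monicP; rewrite lead_coefE sz. Qed.

Lemma pos_coefsM n p (a : R) : 0 < a -> pos_coefs n p -> pos_coefs n.+1 (('X^1 + a%:P) * p).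
Proof.
move=> a0 pn i; rewrite coef_XnDM; case: i => [|i] /=.
  by rewrite add0r mulr_gt0 //; have := pn 0.
rewrite subn1 /= ltnS; have := pn i; have := pn i.+1.
case: (ltngtP i n) => [|ni -> ->|-> -> pi]; last 2 first.
- by rewrite mulr0 addr0.
- by rewrite mulr0 addr0.
by move=> _ ? ?; rewrite addr_gt0 // mulr_gt0.
Qed.

Lemma pos_coefsXn n (a : R) : 0 < a -> pos_coefs n (('X^1 + a%:P) ^+ n).
Proof.
move=> a0; elim: n => [|n IHn]; last by rewrite exprS; exact: pos_coefsM.
by case=> [|i]; rewrite expr0 coef1 ?ltr01.
Qed.

Lemma monic_XD (a : R) : 'X^1 + a%:P \is monic.
Proof. by rewrite expr1 monicXaddC. Qed.

(** Each [k] in the support of [p] contributes the whole interval from [k] to [k + n] to the support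
    of [q]. The successor of an index stays in the same interval, or else the index is at least [n]
    and the interval from [n] to [n + n] takes over. *)
Lemma up_closed_mul_expXD1 p n : nneg_poly p -> size p = n.+1 ->
  let q := p * ('X^1 + 1%:P) ^+ n in
  forall i, (i < n + n)%N -> 0 < q`_i -> 0 < q`_i.+1.
Proof.
move=> pK sz q i lt_i; have [p0 _] := nneg_polyP _ pK.
have rn := pos_coefsXn n (@ltr01 R); rewrite /q {q}.
set r := _ ^+ n in rn *; set q := p * r.
have [r0 _] := nneg_polyP _ (pos_coefs_nneg rn).
have pn : 0 < p`_n.
  by rewrite lt0r p0 andbT -[n]/(n.+1.-1) -sz -lead_coefE lead_coef_eq0; case/andP: pK.
have q_gt0 k l : 0 < p`_k -> (k <= l <= k + n)%N -> 0 < q`_l.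
  move=> pk /andP[kl ln]; rewrite /q coefM (bigD1 (inord k)) //= inordK //.
  rewrite ltr_wpDr ?sumr_ge0 // => [m _|]; first by rewrite mulr_ge0.
  by rewrite mulr_gt0 //; have := rn (l - k)%N; rewrite leq_subLR ln.
move=> qi; have [k /andP[ki pk]] : exists k, (k <= i <= k + n)%N && (0 < p`_k).
  move: qi; rewrite /q coefM => /lt0r_neq0/eqP qi.
  case: (boolP [exists k : 'I_i.+1, (i <= k + n)%N && (0 < p`_k)]) => [/existsP[k /andP[kn pk]]|].
    by exists k; rewrite -ltnS ltn_ord kn.
  rewrite negb_exists => /forallP qi0; case: qi; apply: big1 => k _.
  have := qi0 k; rewrite negb_and => /orP[ik|].
    by have := rn (i - k)%N; rewrite leq_subLR (negPf ik) => ->; rewrite mulr0.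
  by rewrite lt0r p0 andbT negbK => /eqP ->; rewrite mul0r.
have [lt_ik|le_ki] := ltnP i (k + n); first by apply: (q_gt0 k) => //; nlia.
by apply: (q_gt0 n) => //; nlia.
Qed.

(** * Normalization to value 1 at 1 *)

Lemma normPolyP (p : normPoly R) : normalized_nneg p.
Proof. by case: p. Qed.

Lemma nneg_normPoly (p : normPoly R) : nneg_poly p.
Proof.
have /andP[p0 /eqP p1] := normPolyP p; rewrite /nneg_poly p0.
apply: contra_eqN p1 => /eqP ->; by rewrite horner0 eq_sym oner_eq0.
Qed.

Lemma normalized_nneg1 : normalized_nneg (1 : {poly R}).
Proof.
rewrite /normalized_nneg hornerC eqxx andbT.
by apply/polyOverP => k; rewrite coef1 nnegrE ler0n.
Qed.

(** The constant 1 is a default value, never reached when [nneg_poly p] holds. *)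
Definition normalize p : normPoly R :=
  insubd (NormPoly normalized_nneg1) (p.[1]^-1 *: p).

Lemma normalizeE p : nneg_poly p -> normalize p = p.[1]^-1 *: p :> {poly R}.
Proof.
move=> p0; have p1 := nneg_poly_horner_gt0 p0 ltr01.
rewrite -[LHS]/(val (normalize p)) val_insubd /normalized_nneg.
rewrite hornerZ mulVf ?(gt_eqF p1) // eqxx andbT.
rewrite (_ : _ \is a _) //; apply/polyOverP => k.
by have /nneg_polyP[/(_ k) p0k _] := p0; rewrite coefZ nnegrE mulr_ge0 // invr_ge0 ltW.
Qed.

Lemma normalizeM p q : nneg_poly p -> nneg_poly q ->
  normalize (p * q) = normPoly_mul (normalize p) (normalize q).
Proof.
move=> p0 q0; apply/val_inj => /=.
rewrite !normalizeE ?nneg_polyM // hornerM invfM.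
by rewrite -scalerAl -scalerAr scalerA.
Qed.

Lemma normalize_id (p : normPoly R) : normalize p = p.
Proof.
apply/val_inj; rewrite /= normalizeE ?nneg_normPoly //.
by have /andP[_ /eqP ->] := normPolyP p; rewrite invr1 scale1r.
Qed.

End NonnegPoly.

(** * Extension of the map to unnormalized polynomials *)

Section SupportPreservingMultiplicative.
Variables (R : realType) (Phi : normPoly R -> normPoly R).
Hypotheses (Phi_supp : support_preserving Phi) (Phi_mul : multiplicative_map Phi).
Implicit Types p q : {poly R}.

(** On [nneg_poly] this is constant along positive multiples, so identities for it on unnormalized
    polynomials carry scalar factors. *)
Definition Psi p : {poly R} := Phi (normalize p).

Lemma Psi_nneg p : nneg_poly (Psi p).
Proof. exact: nneg_normPoly. Qed.

Lemma Psi_ge0 p i : 0 <= (Psi p)`_i.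
Proof. by have /nneg_polyP[] := Psi_nneg p. Qed.

Lemma PsiM p q : nneg_poly p -> nneg_poly q -> Psi (p * q) = Psi p * Psi q.
Proof. by move=> p0 q0; rewrite /Psi normalizeM // Phi_mul. Qed.

Lemma Psi1 : Psi 1 = 1.
Proof.
have K1 := nneg_polyXn 0 (nneg_polyXnD 0 (@ltr01 R)).
have /andP[_ /mulfI] := Psi_nneg 1; apply.
by rewrite -PsiM // mul1r mulr1.
Qed.

Lemma PsiXn p n : nneg_poly p -> Psi (p ^+ n) = Psi p ^+ n.
Proof.
move=> p0; elim: n => [|n IHn]; first exact: Psi1.
by rewrite exprS PsiM ?nneg_polyXn // IHn -exprS.
Qed.

Lemma Psi_gt0 p i : nneg_poly p -> (0 < (Psi p)`_i) = (0 < p`_i).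
Proof.
move=> p0; have p1 := nneg_poly_horner_gt0 p0 ltr01.
have -> : (0 < p`_i) = (0 < (normalize p)`_i).
  by rewrite normalizeE // coefZ pmulr_rgt0 ?invr_gt0.
by apply/idP/idP => /Phi_supp.
Qed.

Lemma Psi_eq0 p i : nneg_poly p -> ((Psi p)`_i == 0) = (p`_i == 0).
Proof.
move=> p0; have /nneg_polyP[/(_ i) pi _] := p0.
move: (Psi_gt0 i p0); rewrite !lt0r Psi_ge0 pi !andbT => /(congr1 negb).
by rewrite !negbK.
Qed.

(** * Images of binomials and of their products with quadratics *)

Definition shift_coef j a : R :=
  let q := Psi ('X^j + a%:P) in q`_0 / q`_j.

Lemma shift_coef_gt0 j a : (0 < j)%N -> 0 < a -> 0 < shift_coef j a.
Proof.
move=> j0 a0; rewrite divr_gt0 // Psi_gt0 ?nneg_polyXnD // coefD coefXn coefC.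
  by rewrite ltr_wpDl.
by rewrite eqxx gtn_eqF // addr0 ltr01.
Qed.

Lemma PsiXnD j a : (0 < j)%N -> 0 < a ->
  exists2 u, 0 < u & Psi ('X^j + a%:P) = u *: ('X^j + (shift_coef j a)%:P).
Proof.
move=> j0 a0; set q := Psi _.
have qj : 0 < q`_j.
  by rewrite Psi_gt0 ?nneg_polyXnD // coefD coefXn coefC eqxx gtn_eqF // addr0 ltr01.
exists q`_j => //; apply/polyP => i.
rewrite coefZ coefD coefXn coefC.
have [->|ij] := eqVneq i j; first by rewrite gtn_eqF // addr0 mulr1.
have [->|i0] := eqVneq i 0%N; first by rewrite add0r mulrC divfK ?gt_eqF.
rewrite addr0 mulr0; apply/eqP; rewrite Psi_eq0 ?nneg_polyXnD //.
by rewrite coefD coefXn coefC (negPf ij) (negPf i0) addr0.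
Qed.

(** Support preservation allows only exponents divisible by [j] in the image. Of [r], only the signs
    and the zeros are known. *)
Lemma Psi_compXn j p : (0 < j)%N -> nneg_poly p ->
  exists2 r, Psi (p \Po 'X^j) = r \Po 'X^j &
    forall i, 0 <= r`_i /\ (r`_i == 0) = (p`_i == 0).
Proof.
move=> j0 p0; have q0 := nneg_poly_compXn j0 p0; set q := Psi _.
pose r := \poly_(i < size q) q`_(i * j).
have rE i : r`_i = q`_(i * j).
  rewrite coef_poly; case: ltnP => // le_i.
  by rewrite nth_default // (leq_trans le_i) // leq_pmulr.
exists r => [|i]; last first.
  by rewrite rE Psi_eq0 // coef_comp_polyXnM //; split=> //; exact: Psi_ge0.
apply/polyP => i; rewrite coef_comp_poly_Xn //; case: ifPn => ij.
  by rewrite rE divnK.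
by apply/eqP; rewrite Psi_eq0 // coef_comp_poly_Xn // (negPf ij).
Qed.

(* Comparing with [('X^j + e) * quad c (c * e) j], whose coefficient at [2j] is
   nonzero, shows that [- shift_coef j c] is a root in ['X^j]. *)
Lemma Psi_XnD_quad j c e : (0 < j)%N -> 0 < c -> c < e ->
  exists s d, 0 < s /\ Psi (('X^j + c%:P) * quad c (c * e) j) =
    s *: (('X^j + (shift_coef j c)%:P) * quad (shift_coef j c) d j).
Proof.
move=> j0 c0 ce; have e0 := lt_trans c0 ce.
have [u u0 Pc] := PsiXnD j0 c0; have [v v0 Pe] := PsiXnD j0 e0.
have C0 := shift_coef_gt0 j0 c0.
move: Pc Pe C0; set C := shift_coef j c; set E := shift_coef j e => Pc Pe C0.
pose t a : {poly R} := ('X + a%:P) * ('X^2 - c *: 'X + (c * e)%:P).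
have tE a : ('X^j + a%:P) * quad c (c * e) j = t a \Po 'X^j.
  by rewrite XnDE quadE -comp_polyM.
have tcE : t c = 'X^3 + (c * (e - c)) *: 'X + (c * c * e)%:P.
  by rewrite /t -!mul_polyC !(polyCM, polyCB); ring.
have teE : t e = 'X^3 + (e - c) *: 'X^2 + (c * e * e)%:P.
  by rewrite /t -!mul_polyC !(polyCM, polyCB); ring.
have tc_coef i : (t c)`_i =
    (i == 3)%:R + c * (e - c) * (i == 1)%:R + (if i == 0 then c * c * e else 0).
  by rewrite tcE !coefD coefZ coefXn coefX coefC.
have te_coef i : (t e)`_i =
    (i == 3)%:R + (e - c) * (i == 2)%:R + (if i == 0 then c * e * e else 0).
  by rewrite teE !coefD coefZ !coefXn coefC.
have ec0 : 0 < e - c by rewrite subr_gt0.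
have tc0 : nneg_poly (t c) by apply: nneg_XD_quad; rewrite // lexx ltW.
have te0 : nneg_poly (t e) by apply: nneg_XD_quad; rewrite // lexx andbT ltW.
have [rc rcE rc_coef] := Psi_compXn j0 tc0.
have [re reE re_coef] := Psi_compXn j0 te0.
have rc_eq0 i : (t c)`_i = 0 -> rc`_i = 0.
  by move=> ti; apply/eqP; rewrite (rc_coef i).2 ti.
have re_eq0 i : (t e)`_i = 0 -> re`_i = 0.
  by move=> ti; apply/eqP; rewrite (re_coef i).2 ti.
have re2 : 0 < re`_2.
  by rewrite lt0r (re_coef 2).1 (re_coef 2).2 te_coef /= mulr1 add0r addr0 gt_eqF // ec0.
have rc3 : 0 < rc`_3.
  by rewrite lt0r (rc_coef 3).1 (rc_coef 3).2 tc_coef /= mulr0 !addr0 oner_eq0.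
(* After substituting ['X^j], both sides are the image of the product of [quad c (c * e) j] with
   both binomials, grouped in two ways. *)
have cross : v *: (rc * ('X + E%:P)) = u *: (re * ('X + C%:P)).
  apply: (comp_polyXn_inj j0).
  rewrite !comp_polyZ !comp_polyM -!XnDE -rcE -reE !scalerAr -Pc -Pe -!tE.
  rewrite -!PsiM ?nneg_polyXnD ?tE ?nneg_poly_compXn // -!tE.
  by congr Psi; ring.
have cross4 : v * rc`_3 = u * re`_3.
  have := congr1 (fun p : {poly R} => p`_4) cross.
  rewrite !coefZ !mulrDr !coefD !coefMX !coefMC /=.
  by rewrite (rc_eq0 4) ?(re_eq0 4) ?mul0r ?addr0 // ?tc_coef ?te_coef /= mulr0 !addr0.
have cross3 : v * (rc`_3 * E) = u * (re`_2 + re`_3 * C).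
  have := congr1 (fun p : {poly R} => p`_3) cross.
  rewrite !coefZ !mulrDr !coefD !coefMX !coefMC /=.
  by rewrite (rc_eq0 2) ?mulr0 ?add0r ?mulrDr // ?tc_coef /= mulr0 !addr0.
have EC : E - C != 0.
  apply: contraTneq re2 => /eqP; rewrite subr_eq0 => /eqP EC.
  have : u * re`_2 = 0 by move: cross3; rewrite EC mulrA cross4; lra.
  by move/eqP; rewrite mulf_eq0 gt_eqF //= => /eqP ->; rewrite ltxx.
have rootC : rc.[- C] = 0.
  have /eqP := congr1 (fun p : {poly R} => p.[- C]) cross.
  rewrite !hornerZ !hornerM !hornerD !hornerX !hornerC addNr !mulr0.
  rewrite !mulf_eq0 gt_eqF //= [- C + E]addrC (negPf EC) orbF.
  by move/eqP.
have rc_exp : rc = rc`_3 *: 'X^3 + rc`_1 *: 'X + (rc`_0)%:P.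
  apply/polyP => i; rewrite !coefD !coefZ coefXn coefX coefC.
  case: i => [|[|[|[|i]]]] /=; rewrite ?mulr0 ?mulr1 ?add0r ?addr0 //.
    by apply: rc_eq0; rewrite tc_coef /= mulr0 !addr0.
  by apply: rc_eq0; rewrite tc_coef /= mulr0 !addr0.
(* In [('X + C) * ('X^2 - C *: 'X + d)] the square term cancels and the coefficient of ['X] is
   [d - C ^+ 2], which dictates [d]; the constant term then follows from the root [- C]. *)
pose d := C ^+ 2 + rc`_1 / rc`_3.
exists rc`_3, d; split=> //.
rewrite tE rcE XnDE quadE -comp_polyM -comp_polyZ; congr (_ \Po _).
have rc1E : rc`_1 = rc`_3 * (d - C ^+ 2).
  by rewrite /d addrC addKr mulrC divfK ?gt_eqF.
have rc0E : rc`_0 = rc`_3 * C * d.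
  have := congr1 (horner^~ (- C)) rc_exp.
  rewrite /= rootC !hornerD !hornerZ hornerXn hornerX hornerC rc1E => rootE.
  by apply/eqP; rewrite -subr_eq0 [X in _ == X]rootE; apply/eqP; ring.
rewrite {1}rc_exp rc1E rc0E -!mul_polyC !(polyCM, polyCB, polyC_exp) /=; ring.
Qed.

(** * Transport of coefficient ratios *)

Lemma Psi_ratio p n j : nneg_poly p -> size p = n.+1 ->
  (forall i, (i < n)%N -> 0 < p`_i -> 0 < p`_i.+1) ->
  (0 < j <= n)%N -> 0 < p`_(n - j) ->
  (Psi p)`_(n - j) = shift_coef j (p`_(n - j) / p`_n) * (Psi p)`_n.
Proof.
move=> pK sz up jn pnj; have /andP[j0 le_jn] := jn.
have [b [e [b0 ce]]] := exists_nneg_quadM pK sz up jn pnj.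
move: ce; set c := p`_(n - j) / _; set V := (_ * _) => ce VK.
have pn : p`_n != 0 by rewrite -[n]/(n.+1.-1) -sz -lead_coefE lead_coef_eq0; case/andP: pK.
have c0 : 0 < c.
  by rewrite divr_gt0 // lt0r pn; case/nneg_polyP: pK => ->.
have p_gt i : (n < i)%N -> p`_i = 0 by move=> ni; rewrite nth_default // sz.
have q_gt i : (n < i)%N -> (Psi p)`_i = 0.
  by move=> ni; apply/eqP; rewrite Psi_eq0 // p_gt.
have [s [d [s0 PQ]]] := Psi_XnD_quad j0 c0 ce.
have [u u0 Pc] := PsiXnD j0 c0.
have [v v0 Pb] := PsiXnD (ltn0Sn j) b0.
set C := shift_coef j c in PQ Pc *; set B := shift_coef j.+1 b in Pb.
have TK := nneg_XnD_quad j0 c0 ce.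
(* Two groupings of one product into factors in the domain of [Psi], to which [quad] alone does not
   belong. The image of ['X^j + c] is then cancelled. *)
have prodE : (p * (('X^j + c%:P) * quad c (c * e) j)) * ('X^(j.+1) + b%:P) =
    ('X^j + c%:P) * V by rewrite /V; ring.
have := congr1 (@Psi) prodE.
rewrite (PsiM (nneg_polyM pK TK) (nneg_polyXnD _ b0)) (PsiM pK TK).
rewrite (PsiM (nneg_polyXnD j c0) VK) PQ Pc Pb => PE.
have {PE} : (s * v) *: (('X^(j.+1) + B%:P) * (quad C d j * Psi p)) = u *: Psi V.
  apply: (@mulfI _ ('X^j + C%:P)).
    by have /andP[] := nneg_polyXnD j (shift_coef_gt0 j0 c0).
  transitivity (u *: ('X^j + C%:P) * Psi V); first rewrite -PE.
    by rewrite -!mul_polyC polyCM; ring.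
  by rewrite -!mul_polyC; ring.
move/(congr1 (fun q : {poly R} => q`_(n + j * 2).+1)).
have Vtop : V`_(n + j * 2).+1 = 0.
  by rewrite coef_quadM_top // divfK // subrr.
rewrite !coefZ (coef_quadM_top _ _ _ j0 le_jn q_gt).
have /eqP -> : (Psi V)`_(n + j * 2).+1 == 0 by rewrite Psi_eq0 // Vtop.
move/eqP; rewrite mulr0 mulf_eq0 gt_eqF ?mulr_gt0 //= subr_eq0.
by move/eqP.
Qed.

Lemma Psi_ratio_pos p n j : pos_coefs n p -> (0 < j <= n)%N ->
  (Psi p)`_(n - j) = shift_coef j (p`_(n - j) / p`_n) * (Psi p)`_n.
Proof.
move=> pn jn; apply: Psi_ratio => //; [exact: pos_coefs_nneg pn|exact: size_pos_coefs| |].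
- by move=> i ni _; have := pn i.+1; rewrite ni.
- by have := pn (n - j)%N; rewrite leq_subr.
Qed.

Lemma shift_coefD a b : 0 < a -> 0 < b ->
  shift_coef 1 (a + b) = shift_coef 1 a + shift_coef 1 b.
Proof.
move=> a0 b0; have ltn01 := ltnSn 0.
have [u u0 Pa] := PsiXnD ltn01 a0; have [v v0 Pb] := PsiXnD ltn01 b0.
have bK : pos_coefs 1 ('X^1 + b%:P) by rewrite -[_ + _]expr1; exact: pos_coefsXn.
have abK := pos_coefsM a0 bK.
have := Psi_ratio_pos abK (isT : (0 < 1 <= 2)%N).
rewrite PsiM ?nneg_polyXnD // Pa Pb -scalerAl -scalerAr !coefZ !mulrA.
rewrite (pos_coefs_monic abK) ?monicMl ?monic_XD //= divr1.
rewrite subn1 !coef_XnDM !coefD !coefXn !coefC /= !(mulr0, addr0, add0r, mulr1) => h.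
apply: (mulfI (lt0r_neq0 (mulr_gt0 u0 v0))).
by rewrite [a + b]addrC mulrC mulrA -h; ring.
Qed.

(** With [j = m.+1], the constant term of [('X + a) * ('X + 1) ^+ m] is [a]. In the image it is,
    relative to the leading coefficient, the product of [shift_coef 1 a] and
    [shift_coef 1 1 ^+ m]. *)
Lemma shift_coefE j a : (0 < j)%N -> 0 < a ->
  shift_coef j a = a * shift_coef 1 1 ^+ j.
Proof.
case: j => // m _ a0; have ltn01 := ltnSn 0.
have f_gt0 b : 0 < b -> 0 < shift_coef 1 b by move=> b0; apply: shift_coef_gt0.
have [u u0 Pa] := PsiXnD ltn01 a0; have [v v0 P1] := PsiXnD ltn01 (@ltr01 R).
have K1 := pos_coefsXn m (@ltr01 R); have K := pos_coefsM a0 K1.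
have K' := pos_coefsM (f_gt0 _ a0) (pos_coefsXn m (f_gt0 _ ltr01)).
have := Psi_ratio_pos K (leqnn _ : (0 < m.+1 <= m.+1)%N).
rewrite PsiM ?nneg_polyXn ?nneg_polyXnD // PsiXn ?nneg_polyXnD // Pa P1.
rewrite exprZn -scalerAl -scalerAr !coefZ.
rewrite (pos_coefs_monic K) ?monicMl ?monic_exp ?monic_XD //.
rewrite (pos_coefs_monic K') ?monicMl ?monic_exp ?monic_XD //.
rewrite divr1 subnn -!horner_coef0 !hornerM !horner_exp !hornerD !hornerXn !hornerC.
rewrite !add0r expr1n !mulr1 mulrA [RHS]mulrC.
rewrite (additive_pos_linear f_gt0 shift_coefD a0).
move/(mulfI (lt0r_neq0 (mulr_gt0 u0 (exprn_gt0 m v0)))) <-.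
by rewrite exprS -mulrA.
Qed.

(** * The image as a rescaling of the variable *)

Lemma Psi_tilt_up_closed p n : nneg_poly p -> size p = n.+1 ->
  (forall i, (i < n)%N -> 0 < p`_i -> 0 < p`_i.+1) ->
  exists k, Psi p = k *: (p \Po ((shift_coef 1 1)^-1 *: 'X)).
Proof.
move=> pK sz up; set f := shift_coef 1 1.
have f0 : f != 0 by rewrite lt0r_neq0 // shift_coef_gt0 // ltr01.
have [p0 _] := nneg_polyP _ pK.
have pn : p`_n != 0 by rewrite -[n]/(n.+1.-1) -sz -lead_coefE lead_coef_eq0; case/andP: pK.
(* The scalar is forced by the leading coefficient; the ratio rule with [n - i] in place of [j]
   gives every other one in the support. *)
exists ((Psi p)`_n / p`_n * f ^+ n); apply/polyP => i.
rewrite coefZ coef_comp_scaleX exprVn.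
have [pi|pi] := eqVneq p`_i 0.
  by rewrite pi mul0r mulr0; apply/eqP; rewrite Psi_eq0 // pi.
have le_in : (i <= n)%N.
  by rewrite leqNgt; apply: contraNN pi => ni; rewrite nth_default // sz.
have fi : f ^+ i != 0 by rewrite expf_neq0.
move: le_in; rewrite leq_eqVlt => /predU1P[-> |lt_in]; first by field; rewrite pn expf_neq0.
have := @Psi_ratio p n (n - i) pK sz up.
rewrite subKn ?(ltnW lt_in) // subn_gt0 lt_in leq_subr lt0r pi p0.
move=> -> //; rewrite shift_coefE ?subn_gt0 // -/f; last first.
  by rewrite divr_gt0 // lt0r ?pi ?pn p0.
have -> : f ^+ n = f ^+ (n - i) * f ^+ i by rewrite -exprD subnK // ltnW.
field.
by rewrite pn fi.
Qed.

(** The formula holds for [p * ('X + 1) ^+ n], whose support has no gap above an index it contains.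
    It also holds for ['X + 1], whose image is known directly, so that this power can be
    cancelled. *)
Lemma Psi_tilt p : nneg_poly p ->
  exists k, Psi p = k *: (p \Po ((shift_coef 1 1)^-1 *: 'X)).
Proof.
move=> pK; set f := shift_coef 1 1.
have f0 : 0 < f by rewrite shift_coef_gt0 // ltr01.
have [n sz] : exists n, size p = n.+1.
  by exists (size p).-1; rewrite prednK // size_poly_gt0; case/andP: pK.
have XK : nneg_poly ('X^1 + 1%:P : {poly R}) by exact: nneg_polyXnD.
have rK := nneg_polyXn n XK.
have qsz : size (p * ('X^1 + 1%:P) ^+ n) = (n + n).+1.
  rewrite size_mul; [|by case/andP: pK|by case/andP: rK].
  by rewrite sz (size_pos_coefs (pos_coefsXn n (@ltr01 R))) addSn addnS.
have [k] := Psi_tilt_up_closed (nneg_polyM pK rK) qsz (up_closed_mul_expXD1 pK sz).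
have [u u0 P1] := PsiXnD (ltnSn 0) (@ltr01 R).
have {}P1 : Psi ('X^1 + 1%:P) = (u * f) *: (('X^1 + 1%:P) \Po (f^-1 *: 'X)).
  rewrite P1 !expr1 comp_polyD comp_polyX comp_polyC scalerDr [RHS]scalerDr.
  by rewrite scalerA mulfK ?gt_eqF // -!mul_polyC -!polyCM mulr1.
rewrite PsiM // PsiXn // P1 exprZn comp_polyM -/f rmorphXn /= => PE.
exists (k / (u * f) ^+ n).
have c0 : (u * f) ^+ n != 0 by rewrite expf_neq0 // mulf_neq0 // gt_eqF.
have y0 : (('X^1 + 1%:P) \Po (f^-1 *: 'X)) ^+ n != 0 :> {poly R}.
  rewrite expf_neq0 //; apply/eqP => /(congr1 (fun q : {poly R} => q`_0)).
  rewrite coef_comp_scaleX coefD coefXn coefC coef0 expr0 mulr1 add0r.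
  exact/eqP/oner_neq0.
apply: (mulIf y0); apply: (scalerI c0).
by rewrite scalerAr PE -scalerAl [RHS]scalerA mulrCA mulfV // mulr1.
Qed.

End SupportPreservingMultiplicative.

(** * The formula for normalized polynomials *)

Theorem theorem2 (R : realType) (Phi : normPoly R -> normPoly R)
    (Phi_supp : support_preserving Phi) (Phi_mul : multiplicative_map Phi) :
  exists2 gamma : R, 0 < gamma &
    forall (p : normPoly R) (x : R), (Phi p).[x] = p.[gamma * x] / p.[gamma].
Proof.
exists (shift_coef Phi 1 1)^-1 => [|p x].
  by rewrite invr_gt0 shift_coef_gt0 // ltr01.
set g := _^-1; have [k] := Psi_tilt Phi_supp Phi_mul (nneg_normPoly p).
rewrite /Psi normalize_id -/g => PE.
have PEx y : (Phi p).[y] = k * p.[g * y].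
  by rewrite PE hornerZ horner_comp hornerZ hornerX.
(* The scalar [k] is found by evaluating at 1, where [Phi p] takes the value 1. *)
have /andP[_ /eqP] := normPolyP (Phi p); rewrite !PEx mulr1 => kp.
have pg : p.[g] != 0.
  by apply: contra_eqN kp => /eqP ->; rewrite mulr0 eq_sym oner_neq0.
have -> : k = p.[g]^-1 by apply: (mulIf pg); rewrite kp mulVf.
by rewrite mulrC.
Qed.
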